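(* Let $K$ be a field and let $I\subseteq K[x_1,\ldots,x_n]$ be a nonzero proper square-free monomial ideal which satisfies the packing property. Let $f(\mathbf{a})=c_1a_1+\cdots+c_na_n$ be any linear function on $\mathbb{R}^n$ with real coefficients $c_i\geq 0$ for each $i$. Then the linear program ''minimize $f(\mathbf{a})$ subject to $\mathbf{a}\in SP(I)$'' and the linear program ''minimize $f(\mathbf{a})$ subject to $\mathbf{a}\in NP(I)$'' have equal optimum values.
   Context: A square-free monomial ideal of $K[x_1,\ldots,x_n]$ is an ideal generated by square-free monomials; it has a unique irredundant decomposition $I=P_1\cap\cdots\cap P_s$ with each $P_j$ a prime ideal generated by a subset of the variables. Its height $\mathrm{ht}(I)$ is the minimum over $j$ of the number of variables generating $P_j$. A square-free monomial ideal $I$ is König if there is a set of pairwise coprime monomials in $I$ of cardinality $\mathrm{ht}(I)$. The ideal $I$ has the packing property if every ideal obtained from $I$ by setting a (possibly empty) subset of the variables equal to $0$ and a disjoint (possibly empty) subset of the variables equal to $1$ is König. (Convention: the zero ideal and the unit ideal, which may arise this way, are regarded as König.) The Newton polyhedron is $NP(I)=$ the convex hull in $\mathbb{R}^n$ of $\{(a_1,\ldots,a_n)\in\mathbb{N}^n : x_1^{a_1}\cdots x_n^{a_n}\in I\}$, where $\mathbb{N}=\{0,1,2,\ldots\}$. The symbolic polyhedron is $SP(I)=NP(P_1)\cap\cdots\cap NP(P_s)$; equivalently, $SP(I)$ is the set of $\mathbf{y}\in\mathbb{R}^n$ with $y_i\ge 0$ for all $i$ and $\sum_{i: x_i\in P_j}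 y_i\geq 1$ for all $j=1,\ldots,s$. *)

(* Defs.v *)
From mathcomp Require Import all_boot all_order all_algebra.
From mathcomp Require Import boolp classical_sets reals.
From mathcomp Require Import interval_inference convex.
From mathcomp Require Import mpoly.

Set Implicit Arguments.
Unset Strict Implicit.
Unset Printing Implicit Defensive.

Import GRing.Theory Num.Theory.

Local Open Scope classical_set_scope.
Local Open Scope ring_scope.

(* The unit ideal counts as an ideal here, unlike in [idealr_closed]. *)
Definition is_ideal (A : comNzRingType) (J : set A) : Prop :=
  [/\ J 0, forall p q, J p -> J q -> J (p + q) & forall a p, J p -> J (a * p)].

Definition ideal_gen (A : comNzRingType) (G : set A) : set A :=
  smallest (@is_ideal A) G.

Definition squarefree_mnm (n : nat) (m : 'X_{1..n}) : bool :=
  [forall i, m i <= 1]%N.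

Definition coprime_mnm (n : nat) (m1 m2 : 'X_{1..n}) : bool :=
  [forall i, (m1 i == 0%N) || (m2 i == 0%N)].

Definition squarefree_monomial_ideal (K : fieldType) (n : nat)
    (I : set {mpoly K[n]}) : Prop :=
  exists G : set 'X_{1..n},
    (forall m, G m -> squarefree_mnm m) /\
    I = ideal_gen [set ('X_[m] : {mpoly K[n]}) | m in G].

Definition var_prime (K : fieldType) (n : nat) (S : {set 'I_n}) :
    set {mpoly K[n]} :=
  ideal_gen [set 'X_i | i in [set` S]].
Arguments var_prime K {n} S _.

(* The prime components are recorded by the sets of variables generating them. *)
Definition irredundant_decomposition (K : fieldType) (n : nat)
    (I : set {mpoly K[n]}) (D : {set {set 'I_n}}) : Prop :=
  I = \bigcap_(S in [set` D]) var_prime K S /\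
  forall S, S \in D -> \bigcap_(T in [set` (D :\ S)%SET]) var_prime K T <> I.

(* Every square-free monomial ideal has exactly one irredundant decomposition;
   [prime_components] selects it.  On other ideals the value is junk. *)
Definition prime_components (K : fieldType) (n : nat)
    (I : set {mpoly K[n]}) : {set {set 'I_n}} :=
  xget finset.set0 (irredundant_decomposition I).

(* The default value [n] is attained only when it is the true minimum or when
   there are no components, i.e. for the unit ideal. *)
Definition height (K : fieldType) (n : nat) (I : set {mpoly K[n]}) : nat :=
  \big[minn/n]_(S in prime_components I) #|S|.

(* The zero and unit ideals are Koenig by convention. *)
Definition konig (K : fieldType) (n : nat) (I : set {mpoly K[n]}) : Prop :=
  [\/ I = [set 0], I = setT
    | exists s : seq 'X_{1..n},
        [/\ uniq s, size s = height I,
            forall m, m \in s -> I 'X_[m]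
          & {in s &, forall m1 m2, m1 != m2 -> coprime_mnm m1 m2}]].

Definition subst01 (K : fieldType) (n : nat) (Z U : {set 'I_n})
    (p : {mpoly K[n]}) : {mpoly K[n]} :=
  p \mPo [tuple if i \in Z then 0 else if i \in U then 1 else 'X_i | i < n].

(* The minor is kept in the ring in all [n] variables, as the extension of the
   ideal obtained in the remaining ones. *)
Definition minor (K : fieldType) (n : nat) (I : set {mpoly K[n]})
    (Z U : {set 'I_n}) : set {mpoly K[n]} :=
  ideal_gen (subst01 Z U @` I).

Definition packing_property (K : fieldType) (n : nat)
    (I : set {mpoly K[n]}) : Prop :=
  forall Z U : {set 'I_n}, (Z :&: U)%SET = finset.set0 -> konig (minor I Z U).

Definition convex_hull (R : realType) (n : nat) (A : set 'rV[R]_n) :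
    set 'rV[R]_n :=
  smallest (fun C : set 'rV[R]_n => convex_set C) A.

Definition exponent_vector (R : realType) (n : nat) (m : 'X_{1..n}) : 'rV[R]_n :=
  \row_i (m i)%:R.

Definition newton_polyhedron (R : realType) (K : fieldType) (n : nat)
    (I : set {mpoly K[n]}) : set 'rV[R]_n :=
  convex_hull [set exponent_vector R m | m in [set m | I 'X_[m]]].
Arguments newton_polyhedron R {K n} I _.

Definition symbolic_polyhedron (R : realType) (K : fieldType) (n : nat)
    (I : set {mpoly K[n]}) : set 'rV[R]_n :=
  \bigcap_(S in [set` prime_components I]) newton_polyhedron R (var_prime K S).
Arguments symbolic_polyhedron R {K n} I _.

Definition linear_form (R : realType) (n : nat) (c a : 'rV[R]_n) : R :=
  \sum_i c 0 i * a 0 i.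

Definition lp_minimum (R : realType) (T : Type) (f : T -> R) (A : set T)
    (v : R) : Prop :=
  (f @` A) v /\ lbound (f @` A) v.

(* Main.v *)
(* Let F be the up-closed family of supports of the monomials of I.  The primes
   of I are the minimal covers of F, and SP(I) is the set of y >= 0 of weight at
   least 1 on every cover.  The heart of the proof is that the packing property
   makes F ideal (a consequence of a theorem of Lehman): every x >= 0 with
   x(e) >= 1 on all edges e dominates a convex combination of covers.

   By induction on minors one may assume x > 0 (otherwise contract), and, moving
   x along directions orthogonal to its tight edges, that n tight edges a_i have
   linearly independent incidence vectors.  Deleting a vertex j not in a_i and
   using ideality of the deletion, a rank count bounds the number of tight edges
   missing j by the number of vertices missing from a_i.  Double counting forces
   equality, and then the weights 1/(n - |a_i|) turn the a_i into a positive
   multiple of the all-ones vector.  Since F packs, a minimum cover b satisfies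
   |b| <= x(V); so b meets every a_i exactly once and x is the indicator of b.

   Finally, if theta > 0 is the least c-weight of an edge, then c / theta
   dominates a convex combination of covers, so c.y >= theta on SP(I). *)
From mathcomp Require Import all_boot all_order all_algebra.
From mathcomp Require Import zify ring.

Set Implicit Arguments.
Unset Strict Implicit.
Unset Printing Implicit Defensive.

Import Order.TTheory GRing.Theory Num.Theory.

Local Open Scope ring_scope.

(** * Packing families are ideal *)

Definition upclosed (T : finType) (F : {set {set T}}) : Prop :=
  forall e f : {set T}, e \in F -> e \subset f -> f \in F.

Definition covers (T : finType) (F : {set {set T}}) (b : {set T}) : Prop :=
  forall e, e \in F -> exists2 i, i \in e & i \in b.

(** Combinatorial form of the König property: [N] disjoint edges and a cover of size at most [N]
    certify each other's optimality. The first two cases stand for the zero and the unit ideal. *)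
Definition packs (T : finType) (F : {set {set T}}) : Prop :=
  [\/ F = set0, set0 \in F
    | exists (N : nat) (e : 'I_N -> {set T}) (b : {set T}),
        [/\ forall k, e k \in F,
            forall k l i, i \in e k -> i \in e l -> k = l,
            covers F b & (#|b| <= N)%N]].

(* Contracts [U] and deletes everything outside [U] and the image of [f]. *)
Definition trace (S T : finType) (f : S -> T) (U : {set T})
    (F : {set {set T}}) : {set {set S}} :=
  [set e : {set S} | f @: e :|: U \in F].

(** Minors are reindexed along an injection from an ordinal, so that induction on the number of
    vertices applies to them. *)
Definition packs_hereditarily (n : nat) (F : {set {set 'I_n}}) : Prop :=
  forall m (f : 'I_m -> 'I_n) (U : {set 'I_n}),
    injective f -> packs (trace f U F).

Definition fractional_cover (R : numDomainType) (n : nat)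
    (F : {set {set 'I_n}}) (x : 'I_n -> R) : Prop :=
  (forall i, 0 <= x i) /\ (forall e, e \in F -> 1 <= \sum_(i in e) x i).

(** The free index type allows repeated covers, so two combinations can be merged over a disjoint
    sum. *)
Definition dominates_covers (R : numDomainType) (n : nat)
    (F : {set {set 'I_n}}) (x : 'I_n -> R) : Prop :=
  exists (I : finType) (mu : I -> R) (b : I -> {set 'I_n}),
    [/\ forall k, 0 <= mu k, \sum_k mu k = 1, forall k, covers F (b k)
      & forall i, \sum_(k | i \in b k) mu k <= x i].

Lemma upclosed_trace (S T : finType) (f : S -> T) (U : {set T})
    (F : {set {set T}}) : upclosed F -> upclosed (trace f U F).
Proof.
move=> upF e1 e2; rewrite !inE => e1F le12.
by apply: upF e1F _; rewrite setSU // imsetS.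
Qed.

Lemma packs_hereditarily_trace (m n : nat) (f : 'I_m -> 'I_n)
    (U : {set 'I_n}) (F : {set {set 'I_n}}) :
  injective f -> packs_hereditarily F -> packs_hereditarily (trace f U F).
Proof.
move=> injf hF k g V injg.
suff -> : trace g V (trace f U F) = trace (f \o g) (f @: V :|: U) F.
  by apply: hF; apply: inj_comp.
by apply/setP => e; rewrite !inE imsetU (imset_comp f g) setUA.
Qed.

Lemma packs_hereditarily_packs (n : nat) (F : {set {set 'I_n}}) :
  packs_hereditarily F -> packs F.
Proof.
move=> /(_ n id set0 (@inj_id _)).
suff -> : trace id set0 F = F by [].
by apply/setP => e; rewrite inE imset_id setU0.
Qed.

Lemma dominates_covers_le (R : numDomainType) (n : nat)
    (F : {set {set 'I_n}}) (x y : 'I_n -> R) :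
  (forall i, x i <= y i) -> dominates_covers F x -> dominates_covers F y.
Proof.
move=> xy [I [mu [b [mu0 mu1 bF bx]]]]; exists I, mu, b; split => // i.
exact: le_trans (bx i) (xy i).
Qed.

Lemma dominates_covers_cover (R : numDomainType) (n : nat)
    (F : {set {set 'I_n}}) (b : {set 'I_n}) (x : 'I_n -> R) :
  covers F b -> (forall i, (i \in b)%:R <= x i) -> dominates_covers F x.
Proof.
move=> bF bx; exists unit, (fun=> 1), (fun=> b); split => //.
- by rewrite sumr_const card_unit.
- move=> i; apply: le_trans (bx i); case: (i \in b).
    by rewrite sumr_const card_unit.
  by rewrite big_pred0.
Qed.

Lemma dominates_covers_convex (R : numDomainType) (n : nat)
    (F : {set {set 'I_n}}) (x y : 'I_n -> R) (s t : R) :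
  0 <= s -> 0 <= t -> s + t = 1 ->
  dominates_covers F x -> dominates_covers F y ->
  dominates_covers F (fun i => s * x i + t * y i).
Proof.
move=> s0 t0 st [I [mu [b [mu0 mu1 bF bx]]]] [J [nu [d [nu0 nu1 dF dy]]]].
exists (I + J)%type,
  (fun k => match k with inl k => s * mu k | inr k => t * nu k end),
  (fun k => match k with inl k => b k | inr k => d k end).
split.
- by case=> k; apply: mulr_ge0.
- by rewrite big_sumType /= -!mulr_sumr mu1 nu1 !mulr1.
- by case.
- by move=> i; rewrite big_sumType /= -!mulr_sumr lerD // ler_wpM2l.
Qed.

(** * Deleting or contracting one vertex *)

Lemma fractional_cover_delete (R : numDomainType) (n : nat)
    (F : {set {set 'I_n.+1}}) (x : 'I_n.+1 -> R) (j : 'I_n.+1) :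
  fractional_cover F x ->
  fractional_cover (trace (lift j) set0 F) (x \o lift j).
Proof.
move=> [x0 xF]; split=> [i|e]; first exact: x0.
rewrite inE setU0 => /xF; rewrite big_imset //=.
by move=> ? ? _ _; apply: lift_inj.
Qed.

Lemma notin_imset_lift (n : nat) (j : 'I_n.+1) (e : {set 'I_n}) :
  j \notin lift j @: e.
Proof. by apply/imsetP => -[i _ /eqP]; rewrite (negPf (neq_lift _ _)). Qed.

Lemma fractional_cover_contract (R : numDomainType) (n : nat)
    (F : {set {set 'I_n.+1}}) (x : 'I_n.+1 -> R) (j : 'I_n.+1) :
  x j = 0 -> fractional_cover F x ->
  fractional_cover (trace (lift j) [set j] F) (x \o lift j).
Proof.
move=> xj [x0 xF]; split=> [i|e]; first exact: x0.
rewrite inE setUC => /xF; rewrite big_setU1 ?notin_imset_lift //= xj add0r.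
by rewrite big_imset //= => ? ? _ _; apply: lift_inj.
Qed.

Lemma imset_lift_preim (n : nat) (j : 'I_n.+1) (e : {set 'I_n.+1}) :
  lift j @: (lift j @^-1: e) = e :\ j.
Proof.
apply/setP => i; rewrite !inE; apply/imsetP/andP.
  by move=> [k]; rewrite inE => ke ->; rewrite eq_sym neq_lift.
move=> [ij ie]; case: (unliftP j i) => [k ik|/eqP]; last by rewrite (negPf ij).
by exists k => //; rewrite inE -ik.
Qed.

(** A cover of the contraction also covers [F]: for an edge [e], up-closure makes [e :|: [set j]] an
    edge, so [e] without [j] survives in the contraction. Such covers put no weight on [j]. *)
Lemma dominates_covers_contract (R : numDomainType) (n : nat)
    (F : {set {set 'I_n.+1}}) (x : 'I_n.+1 -> R) (j : 'I_n.+1) :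
  upclosed F -> (forall i, 0 <= x i) ->
  dominates_covers (trace (lift j) [set j] F) (x \o lift j) ->
  dominates_covers F x.
Proof.
move=> upF x0 [I [mu [b [mu0 mu1 bF bx]]]].
exists I, mu, (fun k => lift j @: b k); split => //.
- move=> k e eF; have [|i] := bF k (lift j @^-1: e).
    rewrite inE imset_lift_preim setUC; apply: upF eF _.
    by apply/subsetP => i ie; rewrite !inE ie andbT orbN.
  by rewrite inE => ie ib; exists (lift j i) => //; apply: imset_f.
- move=> i; case: (unliftP j i) => [k ->|->].
    apply: le_trans (bx k); rewrite le_eqVlt; apply/orP; left.
    apply/eqP/eq_bigl => l; rewrite mem_imset //; exact: lift_inj.
  by rewrite big_pred0 // => k; rewrite (negPf (notin_imset_lift _ _)).
Qed.

(** * Moving a fractional cover with its tight edges kept tight *)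

(** The ratio test of the simplex method: [t] is the least [s k / - d k] over the decreasing
    quantities. *)
Lemma first_vanishing (R : realFieldType) (K : finType) (s d : K -> R) :
  (forall k, 0 <= s k) -> (exists k, d k < 0) ->
  exists t, [/\ 0 <= t, forall k, 0 <= s k + t * d k
              & exists2 k, d k < 0 & s k + t * d k = 0].
Proof.
move=> s0 [k0 dk0].
case: (@Order.TotalTheory.arg_minP _ _ _ k0 (fun k => d k < 0)
  (fun k => s k / - d k) dk0) => k dk kmin.
exists (s k / - d k); split.
- by rewrite divr_ge0 // oppr_ge0 ltW.
- move=> l; case: (ltP (d l) 0) => [dl|dl].
    have := kmin _ dl; rewrite ler_pdivlMr ?oppr_gt0 // mulrN.
    by rewrite -subr_ge0 opprK.
  by rewrite addr_ge0 // mulr_ge0 // divr_ge0 // oppr_ge0 ltW.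
- exists k => //; rewrite invrN mulrN mulNr divfK ?subrr //.
  by rewrite lt_eqF.
Qed.

Definition tight (R : numDomainType) (n : nat)
    (F : {set {set 'I_n}}) (x : 'I_n -> R) : {set {set 'I_n}} :=
  [set e in F | \sum_(i in e) x i == 1].

Lemma fractional_cover_move (R : realFieldType) (n : nat)
    (F : {set {set 'I_n}}) (x v : 'I_n -> R) :
  fractional_cover F x -> (forall i, 0 < x i) ->
  (forall e, e \in tight F x -> \sum_(i in e) v i = 0) ->
  (exists i, v i < 0) ->
  exists t, [/\ 0 < t, fractional_cover F (fun i => x i + t * v i)
    & (tight F x \proper tight F (fun i => x i + t * v i)) \/
      exists i, x i + t * v i = 0].
Proof.
move=> [x0 xF] xgt0 vt [i0 vi0].
(* [s] lists the slacks of all constraints and [d] their slopes along [v]. Sets outside [F] get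
   slope 0, so they are never the ones to vanish. *)
pose s k := match k with inl i => x i
  | inr e => if e \in F then \sum_(i in e) x i - 1 else 0 end.
pose d k := match k with inl i => v i
  | inr e => if e \in F then \sum_(i in e) v i else 0 end.
have sumE t (e : {set 'I_n}) : \sum_(i in e) (x i + t * v i) =
    \sum_(i in e) x i + t * \sum_(i in e) v i.
  by rewrite big_split mulr_sumr.
have [||t [t0 tall [k dk ek]]] := @first_vanishing R ('I_n + {set 'I_n})%type s d.
- case=> [i|e] /=; first exact: x0.
  by case: ifP => // /xF; rewrite subr_ge0.
- by exists (inl i0).
(* The vanishing constraint was slack at the start, since tight edges have slope zero and all
   coordinates are positive. Hence the move has positive length. *)
have sk : 0 < s k.
  case: k dk {ek} => [i|e] //=; case: ifP => [eF|]; last by rewrite ltxx.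
  move=> ve; rewrite subr_gt0 lt_neqAle xF // andbT eq_sym; apply/eqP => xe1.
  by move: ve; rewrite vt ?ltxx // inE eF xe1 eqxx.
have t_gt0 : 0 < t.
  rewrite lt_neqAle t0 andbT; apply/eqP => t00.
  by move: ek; rewrite -t00 mul0r addr0 => /eqP; rewrite gt_eqF.
exists t; split => //.
  split=> [i|e eF]; first exact: (tall (inl i)).
  by have := tall (inr e); rewrite /= eF sumE addrAC subr_ge0.
case: k dk ek sk => [i|e] /= dk ek sk; first by right; exists i.
left; move: dk ek sk; case: ifP => [eF|_]; last by rewrite ltxx.
move=> dk ek sk; apply/properP; split.
  apply/subsetP => f ft; have := ft; rewrite !inE sumE vt // mulr0 addr0.
  by [].
exists e; rewrite !inE eF /=; last by rewrite -subr_eq0 gt_eqF.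
by rewrite sumE -subr_eq0 addrAC ek.
Qed.

(** Moving along [v] and along [- v] until a new constraint becomes tight exhibits [x] as a convex
    combination of two points already treated. *)
Lemma dominates_covers_move (R : realFieldType) (n : nat)
    (F : {set {set 'I_n}}) (x v : 'I_n -> R) :
  fractional_cover F x -> (forall i, 0 < x i) ->
  (forall e, e \in tight F x -> \sum_(i in e) v i = 0) ->
  (exists i, v i != 0) ->
  (forall y : 'I_n -> R, fractional_cover F y ->
     tight F x \proper tight F y \/ (exists i, y i = 0) ->
     dominates_covers F y) ->
  dominates_covers F x.
Proof.
move=> xF xgt0 vt [i0 vi0] IH.
wlog vneg : v vt vi0 / v i0 < 0.
  move=> W; case: (ltgtP (v i0) 0) => [||v0]; first exact: W.
    move=> v0; apply: (W (fun i => - v i)).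
    - by move=> e /vt ve; rewrite sumrN ve oppr0.
    - by rewrite oppr_eq0.
    - by rewrite oppr_lt0.
  by rewrite v0 eqxx in vi0.
have [|t [t0 tF tI]] := fractional_cover_move xF xgt0 vt; first by exists i0.
have {tI} D1 := IH _ tF tI.
(* Without a positive coordinate of [v] the move along [- v] may never stop, but then [x + t v]
   already lies below [x]. *)
case: (pickP (fun i => 0 < v i)) => [i1 vi1|vle0]; last first.
  apply: dominates_covers_le D1 => i; rewrite gerDl pmulr_rle0 //.
  by rewrite leNgt vle0.
have vt' e : e \in tight F x -> \sum_(i in e) - v i = 0.
  by move=> /vt ve; rewrite sumrN ve oppr0.
have [|u [u0 uF uI]] := fractional_cover_move xF xgt0 vt'.
  by exists i1; rewrite oppr_lt0.
have {uI} D2 := IH _ uF uI.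
have tu : 0 < t + u by rewrite addr_gt0.
apply: dominates_covers_le (dominates_covers_convex
  (s := u / (t + u)) (t := t / (t + u)) _ _ _ D1 D2).
- move=> i; rewrite le_eqVlt; apply/orP; left; apply/eqP.
  by field; rewrite gt_eqF.
- by rewrite divr_ge0 // ltW.
- by rewrite divr_ge0 // ltW.
- by rewrite -mulrDl addrC divff // gt_eqF.
Qed.

(** * Counting and rank bounds for tight edges *)

(** Every row contributes 1 in total, so the [n] column sums add up to [n]; as the degree condition
    bounds each of them by 1, all equal 1. *)
Lemma sum_inv_degree (R : numFieldType) (n : nat) (z : rel 'I_n) :
  (forall i, exists j, z i j) ->
  (forall i j, z i j -> (#|[set l | z l j]| <= #|[set k | z i k]|)%N) ->
  forall j, \sum_(i | z i j) #|[set k | z i k]|%:R^-1 = 1 :> R.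
Proof.
move=> zex zle; pose d i := #|[set k | z i k]|.
have d0 i : (0 < d i)%N.
  by rewrite card_gt0; apply/set0Pn; have [j zj] := zex i; exists j; rewrite inE.
pose f j : R := \sum_(i | z i j) (d i)%:R^-1.
have f1 j : f j <= 1.
  have [i0 z0|z0] := pickP (z^~ j); last by rewrite /f big_pred0.
  pose c := #|[set l | z l j]|.
  have c0 : (0 < c)%N by rewrite card_gt0; apply/set0Pn; exists i0; rewrite inE.
  (* Column [j] has [c] terms, each at most [1 / c] by the degree condition. *)
  apply: (@le_trans _ _ (\sum_(i | z i j) c%:R^-1)).
    apply: ler_sum => i zij.
    by rewrite lef_pV2 ?posrE ?ltr0n // ler_nat zle.
  rewrite sumr_const (_ : #|_| = c); last by rewrite /c cardsE.
  by rewrite -(mulr_natr (c%:R^-1)) mulVf // pnatr_eq0 -lt0n.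
have fsum : \sum_j (1 - f j) = 0.
  rewrite sumrB /f (exchange_big_dep xpredT) //= sumr_const card_ord.
  apply/eqP; rewrite subr_eq0; apply/eqP.
  transitivity (\sum_(i < n) (1 : R)); first by rewrite sumr_const card_ord.
  apply: eq_bigr => i _; rewrite sumr_const (_ : #|_| = d i); last first.
    by rewrite /d cardsE.
  by rewrite -(mulr_natr ((d i)%:R^-1)) mulVf // pnatr_eq0 -lt0n.
move=> j; apply/esym/eqP; rewrite -subr_eq0; apply/eqP.
apply: (psumr_eq0P _ fsum) => // i _; by rewrite subr_ge0.
Qed.

Lemma const_mx1_rank (F : fieldType) (m n : nat) :
  (\rank (const_mx 1%R : 'M[F]_(m, n)) <= 1)%N.
Proof.
have -> : const_mx 1 = (const_mx 1 : 'M[F]_(m, 1)) *m (const_mx 1 : 'M_(1, n)).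
  by apply/matrixP => i j; rewrite !mxE big_ord1 !mxE mulr1.
by apply: leq_trans (mxrankM_maxl _ _) _; apply: rank_leq_col.
Qed.

Lemma sum_cover_card (R : numDomainType) (I T : finType) (mu : I -> R)
    (b : I -> {set T}) (e : {set T}) :
  \sum_k mu k * #|e :&: b k|%:R = \sum_(i in e) \sum_(k | i \in b k) mu k.
Proof.
rewrite (exchange_big_dep xpredT) //=; apply: eq_bigr => k _.
rewrite mulr_natr -sumr_const; apply: eq_bigl => i; by rewrite inE.
Qed.

(* On a tight edge, [1 = sum mu k <= sum mu k * #|e :&: b k| <= sum x i = 1]
   is a chain of equalities. *)
Lemma tight_edge_covers (R : numDomainType) (I : finType) (n : nat)
    (F : {set {set 'I_n}}) (x : 'I_n -> R) (mu : I -> R)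
    (b : I -> {set 'I_n}) (e : {set 'I_n}) :
  (forall k, 0 <= mu k) -> \sum_k mu k = 1 -> (forall k, covers F (b k)) ->
  (forall i, \sum_(k | i \in b k) mu k <= x i) ->
  e \in F -> \sum_(i in e) x i = 1 ->
  (forall k, mu k != 0 -> #|e :&: b k| = 1%N) /\
  (forall i, i \in e -> \sum_(k | i \in b k) mu k = x i).
Proof.
move=> mu0 mu1 bF bx eF xe.
have c1 k : (0 < #|e :&: b k|)%N.
  by have [i ie ib] := bF k e eF; rewrite card_gt0; apply/set0Pn; exists i;
    rewrite inE ie.
have le1 : 1 <= \sum_k mu k * #|e :&: b k|%:R.
  rewrite -[leLHS]mu1; apply: ler_sum => k _.
  by rewrite ler_peMr // ler1n.
have le2 : \sum_(i in e) \sum_(k | i \in b k) mu k <= \sum_(i in e) x i.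
  by apply: ler_sum.
have eq2 : \sum_(i in e) (x i - \sum_(k | i \in b k) mu k) = 0.
  apply/eqP; rewrite sumrB subr_eq0 eq_le le2 andbT xe.
  by rewrite -sum_cover_card.
have eq1 : \sum_k mu k * (#|e :&: b k|.-1)%:R = 0.
  apply/eqP; rewrite eq_le sumr_ge0 ?andbT => [|k _]; last exact: mulr_ge0.
  have : \sum_k mu k * #|e :&: b k|%:R <= 1.
    by rewrite sum_cover_card (le_trans le2) ?xe.
  rewrite -[leRHS]mu1 -subr_le0 -sumrB; congr (_ <= 0).
  apply: eq_bigr => k _; rewrite -(prednK (c1 k)) -natr1.
  by rewrite mulrDr mulr1 addrK.
split=> [k muk|i ie].
  have /eqP := psumr_eq0P (fun k _ => mulr_ge0 (mu0 k) (ler0n _ _)) eq1 (i := k) isT.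
  rewrite mulf_eq0 (negPf muk) /= pnatr_eq0 => /eqP c0.
  by rewrite -(prednK (c1 k)) c0.
apply/esym/eqP; rewrite -subr_eq0; apply/eqP; move: i ie.
by apply: (psumr_eq0P _ eq2) => i _; rewrite subr_ge0.
Qed.

Lemma sum_mem_card (R : pzSemiRingType) (T : finType) (A B : {set T}) :
  \sum_(i in A) (i \in B)%:R = #|A :&: B|%:R :> R.
Proof.
rewrite -sumr_const (eq_bigl _ _ (fun i => in_setI i A B)) big_mkcondr /=.
by apply: eq_bigr => i _; case: ifP.
Qed.

Definition incidence (R : pzSemiRingType) (m n : nat) (a : 'I_m -> {set 'I_n}) :
    'M[R]_(m, n) := \matrix_(i, j) (j \in a i)%:R.

Lemma incidence_mulE (R : pzSemiRingType) (m n p : nat) (a : 'I_m -> {set 'I_n})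
    (B : 'M[R]_(n, p)) i k :
  (incidence R a *m B) i k = \sum_(j in a i) B j k.
Proof.
rewrite mxE [RHS]big_mkcond; apply: eq_bigr => j _.
by rewrite mxE; case: ifP => _; rewrite ?mul1r ?mul0r.
Qed.

Lemma card_preim_lift (n : nat) (j : 'I_n.+1) (e : {set 'I_n.+1}) :
  j \notin e -> #|lift j @^-1: e| = #|e|.
Proof.
move=> je; rewrite -(card_imset _ (@lift_inj _ j)) imset_lift_preim.
by congr #|pred_of_set _|; apply/setDidPl; rewrite disjoint_sym disjoints1.
Qed.

(* The edges missing [j] and the covers picked for the elements of [a i], all
   living outside [j], have the all-ones matrix as product, of rank one. *)
Lemma degree_le (R : realFieldType) (n : nat) (F : {set {set 'I_n.+1}})
    (x : 'I_n.+1 -> R) (a : 'I_n.+1 -> {set 'I_n.+1}) (i j : 'I_n.+1) :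
  (forall k, 0 < x k) -> (forall l, a l \in F) ->
  (forall l, \sum_(k in a l) x k = 1) -> incidence R a \in unitmx ->
  dominates_covers (trace (lift j) set0 F) (x \o lift j) ->
  j \notin a i -> (#|[set l | j \notin a l]| <= #|[set k | k \notin a i]|)%N.
Proof.
move=> x0 aF ax Au [I [mu [b [mu0 mu1 bF bx]]]] jai.
pose e l := lift j @^-1: a l.
have eE l : j \notin a l -> lift j @: e l = a l.
  move=> jal; rewrite imset_lift_preim; apply/setDidPl.
  by rewrite disjoint_sym disjoints1.
have tightE l : j \notin a l -> (forall k, mu k != 0 -> #|e l :&: b k| = 1%N) /\
  (forall v, v \in e l -> \sum_(k | v \in b k) mu k = x (lift j v)).
  move=> jal; apply: (tight_edge_covers mu0 mu1 bF bx).
    by rewrite inE eE // setU0.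
  rewrite -[RHS](ax l) -(eE l jal) big_imset //= => ? ? _ _.
  exact: lift_inj.
(* On a tight edge the combination attains [x], which is positive, so each vertex of [e i] lies in a
   cover of nonzero weight. *)
have /fin_all_exists[c cP] : forall v : 'I_#|e i|,
    exists k, mu k != 0 /\ enum_val v \in b k.
  move=> v; have [_ /(_ _ (enum_valP v)) xv] := tightE i jai.
  have [k /andP[kb muk]|K] := pickP (fun k => (enum_val v \in b k) && (mu k != 0)).
    by exists k.
  have := x0 (lift j (enum_val v)); rewrite -xv big1 ?ltxx // => k kb.
  by have := K k; rewrite kb /= => /negbFE/eqP.
pose L := [set l | j \notin a l].
have LP (l : 'I_#|L|) : j \notin a (enum_val l).
  by have := enum_valP l; rewrite inE.
pose M : 'M[R]_(#|L|, n) := incidence R (fun l => e (enum_val l)).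
pose B : 'M[R]_(#|e i|, n) := incidence R (fun v => b (c v)).
have MB : M *m B^T = const_mx 1.
  apply/matrixP => l v; rewrite incidence_mulE [RHS]mxE.
  under eq_bigr do rewrite !mxE.
  have [muc _] := cP v; have [H _] := tightE _ (LP l).
  by rewrite sum_mem_card H.
(* The rows of [M] are rows of the invertible incidence matrix with the zero entry in column [j]
   removed; a submatrix of the inverse is a right inverse. *)
have Mfree : row_free M.
  apply/row_freeP.
  exists (\matrix_(k, l) invmx (incidence R a) (lift j k) (enum_val l)).
  apply/matrixP => l l'; rewrite incidence_mulE [RHS]mxE.
  under eq_bigr do rewrite mxE.
  have := mulmxV Au; move/matrixP/(_ (enum_val l) (enum_val l')).
  rewrite incidence_mulE [X in _ = X -> _]mxE (inj_eq enum_val_inj) => <-.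
  rewrite -(eE _ (LP l)) big_imset //= => ? ? _ _; exact: lift_inj.
(* The cover picked for [v] meets [e i] in [v] only, so the columns of [B] indexed by [e i] form an
   identity matrix. *)
have Bfree : row_free B.
  apply/row_freeP; exists (\matrix_(k, v) (k == enum_val v)%:R).
  apply/matrixP => v v'; rewrite incidence_mulE [RHS]mxE.
  under eq_bigr do rewrite mxE.
  have [muv vb] := cP v; have [/(_ _ muv)/eqP/cards1P[w ew] _] := tightE i jai.
  have wP (u : 'I_#|e i|) : (enum_val u \in b (c v)) = (enum_val u == w).
    by rewrite -[RHS]in_set1 -ew in_setI enum_valP.
  have -> : (v == v') = (enum_val v' \in b (c v)).
    rewrite wP; move: vb; rewrite wP => /eqP <-.
    by rewrite (inj_eq enum_val_inj) eq_sym.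
  rewrite big_mkcond (bigD1 (enum_val v')) //= eqxx big1 ?addr0.
    by case: ifP.
  by move=> k /negPf ->; case: ifP.
(* Sylvester's inequality with inner dimension [n] gives [#|L| + #|e i| - n <= 1]. The rank one on
   the right makes up for the deleted vertex, which yields [#|L| <= n.+1 - #|a i|]. *)
have := mxrank_mul_min M B^T; rewrite MB mxrank_tr.
move: Mfree Bfree; rewrite /row_free => /eqP -> /eqP ->.
move=> /leq_trans/(_ (const_mx1_rank _ _ _)).
have -> : #|e i| = #|a i| by apply: card_preim_lift.
have -> : [set k | k \notin a i] = ~: a i by apply/setP => k; rewrite !inE.
have := cardsC (a i); rewrite card_ord -/L.
lia.
Qed.

Lemma sum_disjoint_le (R : numDomainType) (n N : nat) (e : 'I_N -> {set 'I_n})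
    (x : 'I_n -> R) :
  (forall i, 0 <= x i) -> (forall k l i, i \in e k -> i \in e l -> k = l) ->
  \sum_k \sum_(i in e k) x i <= \sum_i x i.
Proof.
move=> x0 disj; rewrite (exchange_big_dep xpredT) //=; apply: ler_sum => i _.
have [k ik|none] := pickP (fun k => i \in e k); last by rewrite big_pred0.
rewrite (big_pred1 k) // => l; apply/idP/eqP => [il|-> //].
exact: disj il ik.
Qed.

(* The weights [1 / #|~: a i|] turn the tight edges into a multiple of the
   all-ones vector; a minimum cover is then as tight as [x], hence equal to
   it. *)
Lemma dominates_covers_nonsingular (R : realFieldType) (n : nat)
    (F : {set {set 'I_n.+1}}) (x : 'I_n.+1 -> R) (a : 'I_n.+1 -> {set 'I_n.+1}) :
  packs F -> fractional_cover F x -> (forall k, 0 < x k) ->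
  (forall l, a l \in F) -> (forall l, \sum_(k in a l) x k = 1) ->
  incidence R a \in unitmx ->
  (forall j, dominates_covers (trace (lift j) set0 F) (x \o lift j)) ->
  dominates_covers F x.
Proof.
move=> pF [x0 xF] xgt0 aF ax Au IH.
(* If the whole vertex set is tight, [x] has total weight 1. An edge missing [k] would weigh less
   than 1, so singletons are covers and [x] itself gives the weights. *)
have [/existsP[i0 /eqP ai0]|/existsPn aT] := boolP [exists i, a i == setT].
  have sx : \sum_k x k = 1.
    by rewrite -(ax i0) ai0; apply: eq_bigl => k; rewrite inE.
  exists 'I_n.+1, x, (fun k => [set k]); split => //.
    move=> k e eF; exists k; last by rewrite inE.
    apply: contraTT (xF e eF) => ke; rewrite -ltNge -sx [ltRHS](bigID (mem e)) /=.
    rewrite ltrDl (bigD1 k) //= ltr_wpDr //; exact: sumr_ge0.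
  by move=> i; rewrite (big_pred1 i) // => k; rewrite inE eq_sym.
have deg1 := @sum_inv_degree R n.+1 (fun i j => j \notin a i).
have {}deg1 : forall j,
    \sum_(i | j \notin a i) #|[set k | k \notin a i]|%:R^-1 = 1 :> R.
  apply: deg1.
    move=> i; apply/existsP; apply: contraNT (aT i).
    move/existsPn => H; apply/eqP/setP => k; rewrite inE.
    by have := H k; rewrite negbK.
  move=> i j; exact: degree_le (IH j).
pose w i : R := #|[set k | k \notin a i]|%:R^-1.
have w0 i : 0 < w i.
  rewrite invr_gt0 ltr0n card_gt0; apply/set0Pn.
  apply/existsP; apply: contraNT (aT i).
  move/existsPn => H; apply/eqP/setP => k; rewrite inE.
  by have := H k; rewrite inE negbK.
pose c := \sum_i w i - 1.
(* The edges missing [j] have total weight 1, so those containing [j] carry the rest, independently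
   of [j]. *)
have wcol j : \sum_(i | j \in a i) w i = c.
  apply/eqP; rewrite /c eq_sym subr_eq -(deg1 j) addrC.
  by rewrite (bigID (fun i => j \in a i)) addrC.
have wsum (y : 'I_n.+1 -> R) :
    \sum_i w i * \sum_(j in a i) y j = c * \sum_j y j.
  under eq_bigr do rewrite mulr_sumr.
  rewrite (exchange_big_dep xpredT) //= mulr_sumr; apply: eq_bigr => j _.
  by rewrite -mulr_suml wcol.
have c0 : 0 <= c by rewrite -(wcol ord0) sumr_ge0 // => i _; apply: ltW.
case: pF => [F0|F0|[N [e [b [eF disj bF bN]]]]].
- by have := aF ord0; rewrite F0 inE.
- by have := xF _ F0; rewrite big_set0 ler10.
have xN : #|b|%:R <= \sum_j x j.
  apply: le_trans (sum_disjoint_le x0 disj).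
  apply: (@le_trans _ _ (\sum_(k < N) 1)).
    by rewrite sumr_const card_ord ler_nat.
  by apply: ler_sum => k _; apply: xF.
have bE : \sum_j (j \in b)%:R = #|b|%:R :> R.
  rewrite -[b in RHS]setTI -sum_mem_card.
  by apply: eq_bigl => j; rewrite inE.
have ab1 i : 0 <= \sum_(j in a i) ((j \in b)%:R : R) - 1.
  have [j ja jb] := bF _ (aF i); rewrite subr_ge0 (bigD1 j) //= jb.
  by rewrite lerDl sumr_ge0.
(* The terms are nonnegative because [b] is a cover, and the sum is [c * #|b| - \sum_i w i], at most
   [c * \sum_j x j - \sum_i w i = 0]. *)
have : \sum_i w i * (\sum_(j in a i) (j \in b)%:R - 1) = 0.
  apply/eqP; rewrite eq_le sumr_ge0 ?andbT; last first.
    by move=> i _; rewrite mulr_ge0 // ltW.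
  under eq_bigr do rewrite mulrBr mulr1.
  rewrite sumrB wsum bE subr_le0.
  have <- : \sum_i w i * \sum_(j in a i) x j = \sum_i w i.
    by apply: eq_bigr => i _; rewrite ax mulr1.
  by rewrite wsum ler_wpM2l.
move/psumr_eq0P => wab.
have ab i : \sum_(j in a i) (j \in b)%:R = 1 :> R.
  have /eqP : w i * (\sum_(j in a i) (j \in b)%:R - 1) = 0.
    by apply: wab => // k _; rewrite mulr_ge0 // ltW.
  by rewrite mulf_eq0 gt_eqF //= subr_eq0 => /eqP.
(* Both vectors solve the same nonsingular system with right-hand side 1. *)
have xb : \col_j x j = \col_j (j \in b)%:R.
  apply: (can_inj (mulKmx Au)); apply/colP => i; rewrite !incidence_mulE.
  under eq_bigr do rewrite mxE.
  under [RHS]eq_bigr do rewrite mxE.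
  by rewrite ax ab.
apply: dominates_covers_cover bF _ => j.
by move/colP/(_ j): xb; rewrite !mxE => ->.
Qed.

(** * The induction proving ideality *)

Theorem packing_dominates_covers (R : realFieldType) (n : nat)
    (F : {set {set 'I_n}}) (x : 'I_n -> R) :
  upclosed F -> packs_hereditarily F -> fractional_cover F x ->
  dominates_covers F x.
Proof.
elim: n F x => [|n IHn] F x upF hF xF.
  (* Without vertices an edge would have weight 0, so there is none and the empty set is a cover. *)
  apply: (@dominates_covers_cover _ _ _ set0) => [e /(proj2 xF)|[]//].
  by rewrite big1 ?ler10 // => -[].
(* Inner induction on the number of edges that are not tight. *)
have [m] := ubnP (#|F| - #|tight F x|); elim: m x xF => // m IHm x xF xm.
have zero (y : 'I_n.+1 -> R) : fractional_cover F y ->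
    (exists i, y i = 0) -> dominates_covers F y.
  move=> yF [j yj]; apply: (dominates_covers_contract (j := j)) => //.
    by case: yF.
  apply: IHn; [exact: upclosed_trace|apply: packs_hereditarily_trace => //|].
    exact: lift_inj.
  exact: fractional_cover_contract.
have [/existsP[j /eqP xj]|/existsPn xn0] := boolP [exists j, x j == 0].
  by apply: zero => //; exists j.
have xgt0 j : 0 < x j by rewrite lt_neqAle eq_sym xn0; case: xF => ->.
pose t (r : 'I_#|tight F x|) : {set 'I_n.+1} := enum_val r.
have tP r : (t r \in F) /\ \sum_(k in t r) x k = 1.
  by have := enum_valP r; rewrite inE => /andP[? /eqP].
have [rf|] := boolP (row_full (incidence R t)).
  pose a := t \o fullrankfun rf.
  apply: (@dominates_covers_nonsingular _ _ _ _ a) => //.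
  - exact: packs_hereditarily_packs.
  - by move=> l; case: (tP (fullrankfun rf l)).
  - by move=> l; case: (tP (fullrankfun rf l)).
  - rewrite (_ : incidence R a = rowsub (fullrankfun rf) (incidence R t)).
      exact: fullrowsub_unit.
    by apply/matrixP => i j; rewrite !mxE.
  - move=> j; apply: IHn; [exact: upclosed_trace| |exact: fractional_cover_delete].
    apply: packs_hereditarily_trace => //; exact: lift_inj.
rewrite /row_full -mxrank_tr => /negPf tf.
(* If the tight edges do not span, some nonzero direction is orthogonal to all of them. *)
have : kermx (incidence R t)^T != 0 by rewrite kermx_eq0 /row_free tf.
case/rowV0Pn => v /sub_kermxP vt v0.
apply: (@dominates_covers_move _ _ _ _ (fun i => v 0 i)) => //.
- move=> e et; have := congr1 trmx vt; rewrite trmx_mul trmxK trmx0.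
  move/colP/(_ (enum_rank_in et e)); rewrite incidence_mulE mxE /t enum_rankK_in //.
  by under eq_bigr do rewrite mxE.
- by apply/existsP; apply: contraNT v0 => /existsPn H; apply/eqP/rowP => i;
    rewrite mxE; apply/eqP; rewrite -[_ == _]negbK.
move=> y yF [lt|]; last exact: zero.
apply: IHm => //; have := proper_card lt.
have : (#|tight F y| <= #|F|)%N.
  by apply: subset_leq_card; apply/subsetP => e; rewrite inE => /andP[].
move: xm; lia.
Qed.

Require Import Defs.
From mathcomp Require Import boolp classical_sets reals.
From mathcomp Require Import interval_inference convex mpoly.

(** * Squarefree monomial ideals *)

Definition mnm_support (n : nat) (m : 'X_{1..n}) : {set 'I_n} :=
  [set i | m i != 0%N].

Definition set_mnm (n : nat) (e : {set 'I_n}) : 'X_{1..n} :=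
  [multinom nat_of_bool (i \in e) | i < n].

Lemma mnm_support_set (n : nat) (e : {set 'I_n}) : mnm_support (set_mnm e) = e.
Proof. by apply/setP => i; rewrite inE mnmE; case: (i \in e). Qed.

Lemma mnm_supportD (n : nat) (m1 m2 : 'X_{1..n}) :
  mnm_support (m1 + m2)%MM = mnm_support m1 :|: mnm_support m2.
Proof. by apply/setP => i; rewrite !inE mnmDE addn_eq0 negb_and. Qed.

Lemma squarefree_le (n : nat) (m1 m2 : 'X_{1..n}) :
  squarefree_mnm m1 -> mnm_support m1 \subset mnm_support m2 -> (m1 <= m2)%MM.
Proof.
move=> /forallP sf /fintype.subsetP sub; apply/mnm_lepP => i.
have := sub i; have := sf i; rewrite !inE; case: (m1 i) => [//|[|//]] _.
by rewrite lt0n; apply.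
Qed.

(** For up-closed [F] this is the square-free monomial ideal encoded by [F]; membership is tested
    term by term. *)
Definition support_ideal (K : fieldType) (n : nat) (F : {set {set 'I_n}}) :
    set {mpoly K[n]} :=
  fun p => forall m, m \in msupp p -> mnm_support m \in F.
Arguments support_ideal K {n} F _.

Lemma support_idealX (K : fieldType) (n : nat) (F : {set {set 'I_n}})
    (m : 'X_{1..n}) :
  support_ideal K F 'X_[m] <-> mnm_support m \in F.
Proof.
split=> [/(_ m)|mF k]; rewrite msuppX inE; first by apply.
by move/eqP ->.
Qed.

Lemma support_ideal_set (K : fieldType) (n : nat) (F : {set {set 'I_n}})
    (e : {set 'I_n}) :
  support_ideal K F 'X_[set_mnm e] <-> e \in F.
Proof. by rewrite support_idealX mnm_support_set. Qed.

Lemma support_ideal_inj (K : fieldType) (n : nat) (F G : {set {set 'I_n}}) :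
  support_ideal K F = support_ideal K G -> F = G.
Proof.
move=> FG; apply/setP => e; apply/idP/idP => /(support_ideal_set K).
  by rewrite FG => /support_ideal_set.
by rewrite -FG => /support_ideal_set.
Qed.

Lemma support_ideal_ideal (K : fieldType) (n : nat) (F : {set {set 'I_n}}) :
  upclosed F -> is_ideal (support_ideal K F).
Proof.
move=> upF; split=> [m|p q pF qF m /msuppD_le|a p pF m /msuppM_le].
- by rewrite msupp0.
- by rewrite mem_cat => /orP[/pF|/qF].
- case/allpairsP => -[m1 m2] /= [_ /pF m2F ->].
  by apply: upF m2F _; rewrite mnm_supportD finset.subsetUr.
Qed.

Lemma ideal_gen_ideal (A : comNzRingType) (G : set A) : is_ideal (ideal_gen G).
Proof.
split=> [J [[J0 _ _] _] //|p q pG qG J [iJ GJ]|a p pG J [iJ GJ]].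
  by have [_ + _] := iJ; apply; [apply: pG|apply: qG].
by have [_ _] := iJ; apply; apply: pG.
Qed.

Lemma ideal_gen_mul (A : comNzRingType) (G : set A) (a p : A) :
  G p -> ideal_gen G (a * p).
Proof.
move=> Gp; have [_ _ gM] := ideal_gen_ideal G; apply: gM.
exact: sub_gen_smallest.
Qed.

Lemma ideal_msupp (K : fieldType) (n : nat) (J : set {mpoly K[n]})
    (p : {mpoly K[n]}) :
  is_ideal J -> (forall m, m \in msupp p -> J 'X_[m]) -> J p.
Proof.
move=> [J0 JD JM] pJ; rewrite (mpolyE p) big_seq; apply: big_ind => // m /pJ mJ.
by rewrite -mul_mpolyC; apply: JM.
Qed.

Lemma ideal_gen_support (K : fieldType) (n : nat) (F : {set {set 'I_n}})
    (G : set {mpoly K[n]}) :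
  upclosed F -> (forall p, G p -> support_ideal K F p) ->
  (forall m, mnm_support m \in F -> ideal_gen G 'X_[m]) ->
  ideal_gen G = support_ideal K F.
Proof.
move=> upF GF FG; apply/seteqP; split.
  by apply: smallest_sub => //; apply: support_ideal_ideal.
move=> p pF; apply: ideal_msupp (ideal_gen_ideal G) _ => m /pF; exact: FG.
Qed.

Lemma squarefree_support_ideal (K : fieldType) (n : nat)
    (I : set {mpoly K[n]}) :
  squarefree_monomial_ideal I ->
  exists2 F : {set {set 'I_n}}, upclosed F & I = support_ideal K F.
Proof.
case=> G [sfG ->].
pose F : {set {set 'I_n}} :=
  [set e : {set 'I_n} | `[< exists2 g, G g & mnm_support g \subset e >]].
have upF : upclosed F.
  move=> e f; rewrite !inE => -[g Gg ge] ef; exists g => //.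
  exact: fintype.subset_trans ge ef.
exists F => //; apply: ideal_gen_support => //.
- by move=> _ [g Gg <-]; apply/support_idealX; rewrite !inE; exists g.
- move=> m; rewrite !inE => -[g Gg gm].
  rewrite -(submK (squarefree_le (sfG _ Gg) gm)) mpolyXD.
  by apply: ideal_gen_mul; exists g.
Qed.

(** * Prime components and covers *)

(** The transversals of [D]: the supports of monomials in the intersection of the primes indexed by
    [D]. *)
Definition meeting (T : finType) (D : {set {set T}}) : {set {set T}} :=
  [set e : {set T} | [forall S in D, e :&: S != finset.set0]].

Lemma meetingP (T : finType) (D : {set {set T}}) (e : {set T}) :
  reflect (forall S, S \in D -> exists2 i, i \in e & i \in S) (e \in meeting D).
Proof.
rewrite inE; apply: (iffP forall_inP) => H S /H.
  by case/set0Pn => i; rewrite inE => /andP[]; exists i.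
by case=> i ie iS; apply/set0Pn; exists i; rewrite inE ie.
Qed.

Lemma upclosed_meeting (T : finType) (D : {set {set T}}) : upclosed (meeting D).
Proof.
move=> e f /meetingP eD /fintype.subsetP ef; apply/meetingP => S /eD[i ie iS].
by exists i => //; apply: ef.
Qed.

Lemma var_prime_support (K : fieldType) (n : nat) (S : {set 'I_n}) :
  var_prime K S = support_ideal K (meeting [set S]).
Proof.
apply: ideal_gen_support; first exact: upclosed_meeting.
- move=> _ [i iS <-]; apply/support_idealX/meetingP => T; rewrite inE => /eqP ->.
  by exists i => //; rewrite inE mnm1E eqxx.
- move=> m /meetingP/(_ S (set11 S))[i]; rewrite inE => mi iS.
  have im : (U_(i) <= m)%MM.
    by apply/mnm_lepP => k; rewrite mnm1E; case: eqP => // <-; rewrite lt0n.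
  rewrite -(submK im) mpolyXD.
  by apply: ideal_gen_mul; exists i.
Qed.

Lemma bigcap_var_prime (K : fieldType) (n : nat) (D : {set {set 'I_n}}) :
  (\bigcap_(S in [set` D]) var_prime K S)%classic = support_ideal K (meeting D).
Proof.
apply/seteqP; split=> p.
  move=> pD m mp; apply/meetingP => S SD.
  have := pD S SD; rewrite var_prime_support => /(_ m mp)/meetingP; apply.
  exact: set11.
move=> pD S SD; rewrite var_prime_support => m /pD/meetingP mD.
by apply/meetingP => T; rewrite inE => /eqP ->; apply: mD.
Qed.

(* The complement of a set outside [F] is a cover. *)
Lemma meeting_covers (T : finType) (F : {set {set T}}) :
  upclosed F -> F = meeting [set b : {set T} | `[< covers F b >]].
Proof.
move=> upF; apply/setP => e; apply/idP/meetingP => [eF b|eb].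
  by rewrite !inE; apply.
apply/negPn/negP => eF; have [|i ie] := eb (~: e); last by rewrite inE ie.
rewrite !inE => f fF.
have : ~~ (f \subset e) by apply: contra eF; apply: upF.
by case/subsetPn => i jf ji; exists i => //; rewrite inE.
Qed.

(** [prime_components] is a choice, so an irredundant decomposition must be shown to exist: an
    inclusion-minimal family among those having [F] as their transversals. *)
Lemma prime_components_meeting (K : fieldType) (n : nat)
    (F : {set {set 'I_n}}) :
  upclosed F -> F = meeting (prime_components (support_ideal K F)).
Proof.
move=> upF; suff : irredundant_decomposition (support_ideal K F)
    (prime_components (support_ideal K F)).
  by case; rewrite bigcap_var_prime => /support_ideal_inj.
apply: xgetPex; have := meeting_covers upF; set D0 := (X in meeting X) => FD0.
have [|D /minsetP[/eqP FD Dmin] _] :=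
  @minset_exists _ (fun D => F == meeting D) D0; first exact/eqP.
exists D; split; first by rewrite bigcap_var_prime -FD.
move=> S SD; rewrite bigcap_var_prime => /esym/support_ideal_inj/eqP FS.
have := Dmin _ FS (subD1set _ _); move/setP/(_ S); by rewrite !inE eqxx SD.
Qed.

Lemma prime_components_covers (K : fieldType) (n : nat)
    (F : {set {set 'I_n}}) (S : {set 'I_n}) :
  upclosed F -> S \in prime_components (support_ideal K F) -> covers F S.
Proof.
move=> upF SD e; rewrite [in e \in _](prime_components_meeting K upF).
by move/meetingP; apply.
Qed.

(** If no component lay inside [b], the complement of [b] would meet them all and be an edge missed
    by [b]. *)
Lemma covers_prime_component (K : fieldType) (n : nat)
    (F : {set {set 'I_n}}) (b : {set 'I_n}) :
  upclosed F -> covers F b ->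
  exists2 S, S \in prime_components (support_ideal K F) & S \subset b.
Proof.
move=> upF bF.
have [/exists_inP//|/exists_inPn H] :=
  boolP [exists S in prime_components (support_ideal K F), S \subset b].
have : ~: b \in F.
  rewrite (prime_components_meeting K upF); apply/meetingP => S /H/subsetPn[i iS ib].
  by exists i => //; rewrite inE.
by case/bF => i; rewrite inE => /negPf ->.
Qed.

Lemma height_cover (K : fieldType) (n : nat) (F : {set {set 'I_n}}) :
  upclosed F -> finset.set0 \notin F ->
  exists2 b, covers F b & (#|b| <= height (support_ideal K F))%N.
Proof.
move=> upF F0; rewrite /height.
apply: (big_ind (fun h => exists2 b, covers F b & (#|b| <= h)%N)).
(* The default value [n] of the height is witnessed by the full vertex set, a cover because no edge
   is empty. *)
- exists [set: 'I_n]; last by rewrite cardsT card_ord.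
  move=> e eF; have [e0|[i ie]] := set_0Vmem e; first by rewrite -e0 eF in F0.
  by exists i.
- move=> h1 h2 [b1 b1F bh1] [b2 b2F bh2].
  by rewrite /minn; case: ifP => _; [exists b1|exists b2].
- by move=> S /(prime_components_covers upF) SF; exists S.
Qed.

Lemma konig_packs (K : fieldType) (n : nat) (F : {set {set 'I_n}}) :
  upclosed F -> konig (support_ideal K F) -> packs F.
Proof.
move=> upF [I0|IT|[s [us ss sI scop]]].
- apply: Or31; apply/setP => e; rewrite [RHS]inE; apply/negP => /(support_ideal_set K).
  rewrite I0 => /= /(congr1 (fun p : {mpoly K[n]} => msupp p)).
  by rewrite msuppX msupp0.
- apply: Or32; apply/(support_ideal_set K); by rewrite IT.
have [|F0] := boolP (finset.set0 \in F); first exact: Or32.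
apply: Or33; have [b bF bs] := height_cover K upF F0; rewrite -ss in bs.
exists (size s), (fun k => mnm_support (tnth (in_tuple s) k)), b.
split=> // [k|k l i].
  by apply/(support_idealX K)/sI/mem_tnth.
rewrite !inE => ik il; have [//|kl] := eqVneq k l.
have := scop _ _ (mem_tnth k (in_tuple s)) (mem_tnth l (in_tuple s)).
have /tuple_uniqP/inj_eq -> : uniq (in_tuple s) by [].
by move/(_ kl)/forallP/(_ i); rewrite (negPf ik) (negPf il).
Qed.

(** * Minors of the ideal as minors of the family *)

Lemma subst01X (K : fieldType) (n : nat) (Z U : {set 'I_n}) (m : 'X_{1..n}) :
  subst01 Z U ('X_[m] : {mpoly K[n]}) =
  if mnm_support m :&: Z == finset.set0
  then 'X_[[multinom if i \in U then 0%N else m i | i < n]] else 0.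
Proof.
rewrite /subst01 comp_mpolyX; case: ifPn => [/eqP mZ|/set0Pn[i]].
  rewrite mpolyXE_id; apply: eq_bigr => i _; rewrite tnth_mktuple mnmE.
  case: ifP => iZ.
    have /eqP -> : m i == 0%N.
      by move/setP/(_ i): mZ; rewrite !inE iZ andbT => /negbFE.
    by case: ifP.
  by case: ifP => // _; rewrite expr1n.
rewrite !inE => /andP[mi iZ]; rewrite (bigD1 i) //= tnth_mktuple iZ.
by rewrite expr0n (negPf mi) mul0r.
Qed.

Lemma minor_support (K : fieldType) (n : nat) (F : {set {set 'I_n}})
    (Z U : {set 'I_n}) :
  upclosed F -> Z :&: U = finset.set0 ->
  minor (support_ideal K F) Z U =
    support_ideal K [set e | (e :\: Z) :|: U \in F].
Proof.
move=> upF ZU.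
have upG : upclosed [set e : {set 'I_n} | (e :\: Z) :|: U \in F].
  move=> e f; rewrite !inE => eF ef; apply: upF eF _.
  by rewrite finset.setSU // finset.setSD.
apply: ideal_gen_support => //.
- move=> _ [p pF <-]; rewrite (mpolyE p) /subst01 raddf_sum big_seq.
  apply: big_ind; try by case: (support_ideal_ideal K upG).
  move=> m mp; rewrite [X in support_ideal _ _ X]comp_mpolyZ -mul_mpolyC.
  have [H0 _ HM] := support_ideal_ideal K upG; apply: HM.
  rewrite -/(subst01 Z U _) subst01X; case: eqP => // mZ.
  apply/support_idealX; rewrite inE; apply: upF (pF _ mp) _.
  apply/fintype.subsetP => i im; have := im; rewrite !inE mnmE => mi.
  have iZ : i \notin Z.
    by apply/negP => iZ; move/setP/(_ i): mZ; rewrite !inE mi iZ.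
  by case: ifP; rewrite ?orbT // iZ mi.
- move=> m; rewrite inE => mF.
  (* [e] is an edge avoiding [Z]; the substitution erases its part in [U], and what remains divides
     [m]. *)
  pose e := (mnm_support m :\: Z) :|: U.
  have em : ([multinom if i \in U then 0%N else set_mnm e i | i < n] <= m)%MM.
    apply/mnm_lepP => i; rewrite !mnmE; case: ifP => // iU.
    rewrite !inE iU orbF; have [->|m0] := posnP (m i); first by rewrite andbF.
    exact: leq_trans (leq_b1 _) m0.
  rewrite -(submK em) mpolyXD.
  apply: ideal_gen_mul; exists 'X_[set_mnm e]; first exact/support_ideal_set.
  rewrite subst01X mnm_support_set ifT //; apply/eqP/setP => i.
  move/setP/(_ i): ZU; rewrite /e !inE.
  by case: (i \in Z); case: (i \in U); rewrite ?andbF.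
Qed.

(** Setting to zero the variables outside [U] and the image of [f] gives a minor [G] on all [n]
    vertices. Preimages under [f] carry its disjoint edges and its cover to the trace, and
    injectivity keeps the cover small. *)
Lemma packing_packs_hereditarily (K : fieldType) (n : nat)
    (F : {set {set 'I_n}}) :
  upclosed F -> packing_property (support_ideal K F) -> packs_hereditarily F.
Proof.
move=> upF pI m f U injf.
pose Z := ~: (f @: [set: 'I_m] :|: U).
have ZU : Z :&: U = finset.set0.
  by apply/setP => i; rewrite !inE; case: (i \in U); rewrite ?orbT ?andbF.
pose G := [set e : {set 'I_n} | (e :\: Z) :|: U \in F].
have upG : upclosed G.
  move=> e g; rewrite !inE => eF eg; apply: upF eF _.
  by rewrite finset.setSU // finset.setSD.
have preG e : e \in G -> f @^-1: e \in trace f U F.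
  rewrite !inE => eF; apply: upF eF _; apply/fintype.subsetP => i.
  rewrite !inE negbK => /orP[/andP[/orP[/imsetP[k _ ->]|->] ie]|->]; rewrite ?orbT //.
  by rewrite imset_f // inE.
have imG e : e \in trace f U F -> f @: e \in G.
  rewrite !inE => eF; apply: upF eF _; apply: finset.setSU.
  apply/fintype.subsetP => i /imsetP[k ke ->]; rewrite !inE negbK.
  by rewrite !imset_f ?inE.
have : packs G.
  by apply: (@konig_packs K _ _ upG); rewrite -(minor_support K upF ZU); apply: pI.
case=> [G0|G0|[N [e [b [eG disj bG bN]]]]].
- apply: Or31; apply/setP => e; rewrite [RHS]inE; apply/negP => /imG.
  by rewrite G0 inE.
- by apply: Or32; have := preG _ G0; rewrite preimset0.
apply: Or33; exists N, (fun k => f @^-1: e k), (f @^-1: b); split.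
- by move=> k; apply/preG/eG.
- by move=> k l i; rewrite !inE; apply: disj.
- by move=> g /imG/bG[_ /imsetP[k kg ->] kb]; exists k => //; rewrite inE.
apply: leq_trans bN; rewrite -(card_imset _ injf); apply: subset_leq_card.
by apply/fintype.subsetP => i /imsetP[k]; rewrite inE => kb ->.
Qed.

(** * The two polyhedra *)

(** A half-space is convex, so it contains the hull as soon as it contains the exponent vectors. *)
Lemma newton_polyhedron_ge (R : realType) (K : fieldType) (n : nat)
    (F : {set {set 'I_n}}) (c y : 'rV[R]_n) (v : R) :
  (forall m, mnm_support m \in F -> v <= linear_form c (exponent_vector R m)) ->
  newton_polyhedron R (support_ideal K F) y -> v <= linear_form c y.
Proof.
move=> vF; move: y; apply: smallest_sub; last first.
  by move=> _ [m /support_idealX/vF mv <-].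
move=> x z l; rewrite !inE /= => vx vz.
rewrite -[conv l x z]/(l%:num *: x + (1 - l%:num) *: z : 'rV[R]_n).
have -> : linear_form c (l%:num *: x + (1 - l%:num) *: z) =
    l%:num * linear_form c x + (1 - l%:num) * linear_form c z.
  rewrite /linear_form !mulr_sumr -big_split; apply: eq_bigr => i _.
  by rewrite !mxE mulrDr !(mulrCA (c _ _)).
rewrite -[v](_ : l%:num * v + (1 - l%:num) * v = v); last first.
  by rewrite -mulrDl addrC subrK mul1r.
by rewrite lerD // ler_wpM2l // subr_ge0.
Qed.

Lemma linear_form_exponent_ge (R : realType) (n : nat) (c : 'rV[R]_n)
    (m : 'X_{1..n}) :
  (forall i, 0 <= c 0 i) ->
  \sum_(i in mnm_support m) c 0 i <= linear_form c (exponent_vector R m).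
Proof.
move=> c0; rewrite /linear_form [leLHS]big_mkcond; apply: ler_sum => i _.
rewrite mxE inE; case: eqP => [->|/eqP m0] /=; first by rewrite mulr0.
by rewrite ler_peMr // ler1n lt0n.
Qed.

Lemma linear_form_set_mnm (R : realType) (n : nat) (c : 'rV[R]_n)
    (e : {set 'I_n}) :
  linear_form c (exponent_vector R (set_mnm e)) = \sum_(i in e) c 0 i.
Proof.
rewrite /linear_form [RHS]big_mkcond; apply: eq_bigr => i _.
by rewrite mxE mnmE; case: (i \in e); rewrite ?mulr1 ?mulr0.
Qed.

Lemma newton_exponent (R : realType) (K : fieldType) (n : nat)
    (F : {set {set 'I_n}}) (e : {set 'I_n}) :
  e \in F ->
  newton_polyhedron R (support_ideal K F) (exponent_vector R (set_mnm e)).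
Proof.
move=> eF; apply: sub_gen_smallest.
by exists (set_mnm e) => //; apply/support_ideal_set.
Qed.

Lemma symbolic_exponent (R : realType) (K : fieldType) (n : nat)
    (F : {set {set 'I_n}}) (e : {set 'I_n}) :
  upclosed F -> e \in F ->
  symbolic_polyhedron R (support_ideal K F) (exponent_vector R (set_mnm e)).
Proof.
move=> upF eF S SD; rewrite var_prime_support; apply: newton_exponent.
apply/meetingP => T; rewrite inE => /eqP ->.
exact: (prime_components_covers upF SD).
Qed.

(** The Newton polyhedron of a prime lies in the orthant; at least one component exists because no
    edge is empty. *)
Lemma symbolic_ge0 (R : realType) (K : fieldType) (n : nat)
    (F : {set {set 'I_n}}) (y : 'rV[R]_n) :
  upclosed F -> finset.set0 \notin F ->
  symbolic_polyhedron R (support_ideal K F) y -> forall i, 0 <= y 0 i.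
Proof.
move=> upF F0 yS i; have [b bF _] := height_cover K upF F0.
have [S SD _] := covers_prime_component K upF bF.
have dE (z : 'rV[R]_n) : linear_form (delta_mx 0 i) z = z 0 i.
  rewrite /linear_form (bigD1 i) //= big1 => [|j ji].
    by rewrite mxE !eqxx mul1r addr0.
  by rewrite mxE (negPf ji) andbF mul0r.
rewrite -dE; have := yS S SD; rewrite var_prime_support.
by apply: newton_polyhedron_ge => m _; rewrite dE mxE.
Qed.

(** The inequality holds for a component inside [b], and nonnegativity of [y] extends it to [b]. *)
Lemma symbolic_cover_ge1 (R : realType) (K : fieldType) (n : nat)
    (F : {set {set 'I_n}}) (y : 'rV[R]_n) (b : {set 'I_n}) :
  upclosed F -> finset.set0 \notin F ->
  symbolic_polyhedron R (support_ideal K F) y -> covers F b ->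
  1 <= \sum_(i in b) y 0 i.
Proof.
move=> upF F0 yS bF; have y0 := symbolic_ge0 upF F0 yS.
have [S SD /fintype.subsetP Sb] := covers_prime_component K upF bF.
pose c : 'rV[R]_n := \row_i (i \in S)%:R.
have cE (z : 'rV[R]_n) : linear_form c z = \sum_(i in S) z 0 i.
  rewrite /linear_form [RHS]big_mkcond; apply: eq_bigr => i _.
  by rewrite mxE; case: (i \in S); rewrite ?mul1r ?mul0r.
apply: (@le_trans _ _ (\sum_(i in S) y 0 i)).
  rewrite -cE; have := yS S SD; rewrite var_prime_support.
  apply: newton_polyhedron_ge => m /meetingP/(_ S (set11 S))[i im iS].
  rewrite cE (bigD1 i) //= mxE ler_wpDr ?sumr_ge0 // => [j _|].
    by rewrite mxE.
  by rewrite ler1n lt0n; move: im; rewrite inE.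
rewrite big_mkcond [leRHS]big_mkcond; apply: ler_sum => i _.
by case: ifP => [/Sb ->//|_]; case: ifP.
Qed.

(** * Equality of the two optimum values *)

Lemma packing_blocking_bound (R : realFieldType) (n : nat)
    (F : {set {set 'I_n}}) (c y : 'I_n -> R) (theta : R) :
  upclosed F -> packs_hereditarily F ->
  (forall i, 0 <= c i) -> (forall i, 0 <= y i) ->
  (forall b, covers F b -> 1 <= \sum_(i in b) y i) ->
  (forall e, e \in F -> theta <= \sum_(i in e) c i) ->
  theta <= \sum_i c i * y i.
Proof.
move=> upF hF c0 y0 yb ce; have [t0|t0] := leP theta 0.
  by apply: le_trans t0 _; apply: sumr_ge0 => i _; apply: mulr_ge0.
have [|I [mu [b [mu0 mu1 bF bc]]]] :=
  @packing_dominates_covers R n F (fun i => c i / theta) upF hF.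
  split=> [i|e /ce]; first by rewrite divr_ge0 // ltW.
  by rewrite -mulr_suml ler_pdivlMr // mul1r.
(* Each cover has [y]-weight at least 1; exchanging the sums then bounds the coefficient of [y i] by
   [theta * (c i / theta)]. *)
apply: (@le_trans _ _ (theta * \sum_k mu k * \sum_(i in b k) y i)).
  rewrite ler_peMr ?(ltW t0) // -[leLHS]mu1; apply: ler_sum => k _.
  by rewrite ler_peMr // yb.
under eq_bigr do rewrite mulr_sumr.
rewrite (exchange_big_dep xpredT) //= mulr_sumr; apply: ler_sum => i _.
rewrite -mulr_suml mulrA ler_wpM2r // mulrC -ler_pdivlMr //.
Qed.

Local Open Scope classical_set_scope.

Theorem theorem4p2 (R : realType) (K : fieldType) (n : nat)
    (I : set {mpoly K[n]}) (hI : squarefree_monomial_ideal I)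
    (hI0 : I <> [set 0]) (hI1 : I <> setT) (hpack : packing_property I)
    (c : 'rV[R]_n) (hc : forall i, 0 <= c 0 i) :
  exists v : R,
    lp_minimum (linear_form c) (symbolic_polyhedron R I) v /\
    lp_minimum (linear_form c) (newton_polyhedron R I) v.
Proof.
have [F upF IF] := squarefree_support_ideal hI; subst I.
have F0 : finset.set0 \notin F.
  apply/negP => F0; apply: hI1; apply/seteqP; split=> // p _ m _.
  exact: upF F0 (finset.sub0set _).
have [e0 e0F] : exists e, e \in F.
  have [FE|[e eF]] := set_0Vmem F; last by exists e.
  exfalso; apply: hI0; apply/seteqP; split=> p /=.
    move=> pF; apply: msuppnil0; case E: (msupp p) => [//|m s].
    by have := pF m; rewrite E mem_head FE finset.in_set0 => /(_ isT).
  by move=> -> m; rewrite msupp0.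
(* The indicator of an edge of least [c]-weight is optimal for both programs. *)
case: (@Order.TotalTheory.arg_minP _ _ _ e0 (mem F)
  (fun e => \sum_(i in e) c 0 i) e0F) => e eF emin.
exists (\sum_(i in e) c 0 i); split; split.
- exists (exponent_vector R (set_mnm e)); last exact: linear_form_set_mnm.
  exact: symbolic_exponent.
- move=> _ [y yS <-]; apply: (packing_blocking_bound upF) => //.
  + exact: (packing_packs_hereditarily upF hpack).
  + exact: symbolic_ge0 yS.
  + by move=> b; apply: symbolic_cover_ge1 yS.
- exists (exponent_vector R (set_mnm e)); last exact: linear_form_set_mnm.
  exact: newton_exponent.
- move=> _ [y yN <-]; apply: newton_polyhedron_ge yN => m /emin em.
  exact: le_trans em (linear_form_exponent_ge _ hc).
Qed.
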